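(* Let $M$ be an $m\times n$ $(0,1)$-matrix and $C$ a set of triples. Then $C$ is a critical set of $M$ if and only if $C\subseteq M$ and the rows and columns of $M$ (and correspondingly of $C$) can be permuted so that there exists a South-East walk $W$ (from the top-left corner to the bottom-right corner of $M$) such that: (i) within the cells not occupied by $C$, every cell below $W$ contains $1$ and every cell above $W$ contains $0$; (ii) every cell of every block bordering $W$ from below contains $1$; (iii) every cell of every block bordering $W$ from above contains $0$.
   Context: $\mathcal A(R,S)$ denotes the set of $(0,1)$-matrices with row sum vector $R$ and column sum vector $S$; $M$ is considered in $\mathcal A(R,S)$ for its own row and column sums. A $(0,1)$-matrix is identified with the set of triples $\{(i,j,M_{ij})\}$. A subset $D\subseteq M$ is a defining set for $M$ if $M$ is the unique element of $\mathcal A(R,S)$ containing $D$; a critical set is a defining set none of whose proper subsets is a defining set. Embed $M$ in the plane so that cell $(i,j)$ is the unit square bounded by $x=j-1$, $x=j$, $y=-i$, $y=1-i$. A South-East walk is a lattice path from $(0,0)$ to $(n,-m)$ using unit steps East $(+1,0)$ and South $(0,-1)$. For each row $i$, $W$ has exactly one South step from height $1-i$ to $-i$, at $x$-coordinate $h_i$; cell $(i,j)$ is below $W$ if $j\le h_i$ and above $W$ otherwise. The maximal runs of consecutive South steps of $W$ partition the rows into consecutive intervals, and the maximal runs of consecutive East steps partition the columns into consecutive intervals; a block is the set of cells $R\times J$ for such a row interval $R$ and column interval $J$ (all cells of a block lie on the same side of $W$). A block borders $W$ from below (resp. above) if it lies below (resp. above) $W$ and its boundary shares a segment of positive length with $W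$.
   Formalization: The walk must also satisfy that each cell occupied by C contains 0 if below W and 1 if above W; without this the ''if'' direction fails, e.g. for M=[1], C=M, W=East,South, where (i)-(iii) hold but the empty set is already a defining set. *)

(* Defs.v *)
From mathcomp Require Import all_boot perm matrix.

Set Implicit Arguments.
Unset Strict Implicit.
Unset Printing Implicit Defensive.

(* A (0,1)-matrix is a boolean matrix (true = 1, false = 0); indices start
   at 0, so that cell (i, j) is the unit square j <= x <= j + 1,
   i <= depth <= i + 1, where depth = - y. *)

Section Matrices.
Variables m n : nat.
Implicit Types (M : 'M[bool]_(m, n)) (C D : {set 'I_m * 'I_n * bool}).

Definition row_sum M (i : 'I_m) : nat := \sum_(j < n) M i j.
Definition col_sum M (j : 'I_n) : nat := \sum_(i < m) M i j.

Definition margin_class (R : 'I_m -> nat) (S : 'I_n -> nat) :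
    {set 'M[bool]_(m, n)} :=
  [set M | [forall i, row_sum M i == R i] && [forall j, col_sum M j == S j]].

Definition triples M : {set 'I_m * 'I_n * bool} :=
  [set t | M t.1.1 t.1.2 == t.2].

Definition defining_set M D : Prop :=
  D \subset triples M /\
  (forall N, N \in margin_class (row_sum M) (col_sum M) ->
     D \subset triples N -> N = M).

Definition critical_set M C : Prop :=
  defining_set M C /\ (forall D, D \proper C -> ~ defining_set M D).

Definition permute_mx (s : 'S_m) (t : 'S_n) M : 'M[bool]_(m, n) :=
  row_perm s (col_perm t M).

(* Same convention as [row_perm]: the new cell (i, j) is the old cell
   (s i, t j). *)
Definition permute_triples (s : 'S_m) (t : 'S_n) C :
    {set 'I_m * 'I_n * bool} :=
  [set x | (s x.1.1, t x.1.2, x.2) \in C].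

Definition occupied C (c : 'I_m * 'I_n) : bool :=
  [exists b, (c.1, c.2, b) \in C].

End Matrices.

Definition step : Type := bool.
Definition East : step := true.
Definition South : step := false.

(* After k steps from (0, 0), W is at the point (walk_x W k, - walk_d W k). *)
Definition walk_x (W : seq step) (k : nat) : nat := count_mem East (take k W).
Definition walk_d (W : seq step) (k : nat) : nat := count_mem South (take k W).

Definition is_walk (m n : nat) (W : seq step) : Prop :=
  count_mem East W = n /\ count_mem South W = m.

(* Position in W of its i-th step equal to s (counting from 0): the South
   step crossing row i, or the East step crossing column i. *)
Definition step_time (s : step) (W : seq step) (i : nat) : nat :=
  nth (size W) [seq k <- iota 0 (size W) | nth East W k == s] i.

(* The steps a, ..., b - 1 of W form a maximal run of steps equal to s. *)
Definition max_run (s : step) (W : seq step) (a b : nat) : Prop :=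
  [/\ a < b <= size W,
      (forall k, a <= k < b -> nth East W k = s),
      (0 < a -> nth East W a.-1 <> s)
    & (b < size W -> nth East W b <> s)].

Section Blocks.
Variables m n : nat.
Implicit Types (W : seq step) (B : {set 'I_m * 'I_n}).

Definition walk_height_x W (i : 'I_m) : nat := walk_x W (step_time South W i).

Definition below W : {set 'I_m * 'I_n} :=
  [set c : 'I_m * 'I_n | c.2 < walk_height_x W c.1].
Definition above W : {set 'I_m * 'I_n} := ~: below W.

Definition is_block W B : Prop :=
  exists a b a' b', [/\ max_run South W a b, max_run East W a' b' &
    B = setX [set i : 'I_m | a <= step_time South W i < b]
             [set j : 'I_n | a' <= step_time East W j < b']].

(* A unit lattice segment is (direction, x, depth) for the segment traversed
   by one step in that direction from the point (x, - depth). *)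
Definition walk_segments W : seq (step * nat * nat) :=
  [seq (nth East W k, walk_x W k, walk_d W k) | k <- iota 0 (size W)].

Definition sides (c : 'I_m * 'I_n) : seq (step * nat * nat) :=
  [:: (South, nat_of_ord c.2, nat_of_ord c.1); (South, c.2.+1, nat_of_ord c.1);
      (East, nat_of_ord c.2, nat_of_ord c.1); (East, nat_of_ord c.2, c.1.+1)].

(* The boundary of a union B of cells is made of the unit segments that are
   a side of exactly one cell of B.  Since W and this boundary are both unions
   of unit lattice segments, they share a segment of positive length iff they
   have a unit segment in common. *)
Definition on_boundary B (e : step * nat * nat) : bool :=
  #|[set c in B | e \in sides c]| == 1.

Definition meets_walk W B : Prop :=
  exists2 e, e \in walk_segments W & on_boundary B e.

Definition borders_from_below W B : Prop :=
  [/\ is_block W B, B \subset below W & meets_walk W B].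
Definition borders_from_above W B : Prop :=
  [/\ is_block W B, B \subset above W & meets_walk W B].

End Blocks.

Arguments below {m n} W.
Arguments above {m n} W.

(* Main.v *)
(* Orient the complete bipartite graph on rows and columns: a 1 in cell (i, j)
   is an arc from column j to row i, a 0 an arc from row i to column j.  Matrices
   with the same margins differ by reversing arc-disjoint cycles, so D is a
   defining set iff the arcs outside D form an acyclic graph, i.e. iff some
   potential on rows and columns increases along them.  Critical sets are thus
   the minimal feedback arc sets.  Sorting the vertices by a potential gives a
   South-East walk (South = row, East = column) for which the cells outside C
   are exactly the forward arcs.  A backward arc between two consecutive runs
   could be made forward by reordering within the runs and swapping its ends,
   against minimality; conversely, when all arcs between consecutive runs are
   forward, every backward arc closes a cycle with forward arcs. *)

Require Import Defs.
From mathcomp Require Import all_boot perm matrix zify.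

Set Implicit Arguments.
Unset Strict Implicit.
Unset Printing Implicit Defensive.

(** * Potentials and cycles in finite directed graphs *)

(** The number of vertices that can reach a given vertex strictly increases along every arc lying on
    no cycle. If an arc from [u] to [v] does lie on one, each vertex on a walk from [v] to [u] has a
    successor of the same kind. *)
Lemma potential_or_no_sink (T : finType) (e : rel T) :
  (exists p : T -> nat, forall u v, e u v -> p u < p v) \/
  (exists2 X : {set T}, X != set0 &
     forall u, u \in X -> exists2 v, v \in X & e u v).
Proof.
case: (boolP [exists u, [exists v, e u v && connect e v u]]); last first.
  move=> /existsPn acyc; left; exists (fun w => #|[set x | connect e x w]|).
  move=> u v euv; apply: proper_card; apply/properP; split.
    by apply/subsetP=> x; rewrite !inE => /connect_trans -> //; apply: connect1.
  exists v; rewrite !inE ?connect0 //.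
  by move: (acyc u) => /existsPn /(_ v); rewrite euv.
case/existsP=> u /existsP[v /andP[euv cvu]]; right.
exists [set w | connect e v w && connect e w u].
  by apply/set0Pn; exists v; rewrite inE connect0.
move=> w; rewrite inE => /andP[cvw /connectP[[|x s] /=]].
  by move=> _ <-; exists v; rewrite // inE connect0.
move=> /andP[ewx xs] uE; exists x => //; rewrite inE.
rewrite (connect_trans cvw (connect1 ewx)) /=.
by apply/connectP; exists s.
Qed.

(** A minimal nonempty set [P] stable under a choice [f] of successors equals its image, which is
    stable too; so [f] permutes [P], and its orbits are disjoint cycles. *)
Lemma successor_cycles (T : finType) (e : rel T) (X : {set T}) :
  X != set0 -> (forall u, u \in X -> exists2 v, v \in X & e u v) ->
  exists f : T -> T, exists P : {set T},
    [/\ P != set0, f @: P = P, {in P &, injective f}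
      & forall u, u \in P -> e u (f u)].
Proof.
move=> X0 succX.
pose f u := odflt u [pick v in X | e u v].
have fP u : u \in X -> f u \in X /\ e u (f u).
  rewrite /f => /succX[v vX euv]; case: pickP => [w /andP[] //|/(_ v)].
  by rewrite vX euv.
pose closedb (P : {set T}) := (P != set0) && (f @: P \subset P).
have clX : closedb X.
  by rewrite /closedb X0; apply/subsetP=> _ /imsetP[u uX ->]; case: (fP u uX).
have [P /minsetP[/andP[P0 fPP] Pmin] PX] := minset_exists clX.
have fPE : f @: P = P.
  apply: Pmin => //; rewrite /closedb imsetS // andbT.
  by have /set0Pn[u uP] := P0; apply/set0Pn; exists (f u); apply: imset_f.
exists f, P; split=> //.
  by apply/imset_injP; rewrite fPE.
by move=> u /(subsetP PX) /fP[].
Qed.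

Lemma sum_pred_unique (T : finType) (v : T) (P : pred T) :
  (forall u, P u -> u = v) -> P v -> \sum_u (P u : nat) = 1.
Proof.
move=> uniq Pv; rewrite (bigD1 v) //= Pv big1 // => u uv.
by case: (boolP (P u)) => // /uniq uE; rewrite uE eqxx in uv.
Qed.

(** * Potentials and defining sets *)

Section Potentials.
Variables m n : nat.
Implicit Types (M N : 'M[bool]_(m, n)) (C D : {set 'I_m * 'I_n * bool}).

Definition is_potential M D (p : 'I_m -> nat) (q : 'I_n -> nat) : Prop :=
  forall i j, (i, j, M i j) \notin D ->
    if M i j then q j < p i else p i < q j.

(* Summing [p i - q j] against [M - N] gives 0 by equality of the margins,
   while every cell contributes a nonnegative amount, zero only if [M] and [N]
   agree there. *)
Lemma potential_defining M D p q :
  D \subset triples M -> is_potential M D p q -> defining_set M D.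
Proof.
move=> DM pot; split=> // N; rewrite inE => /andP[/forallP rN /forallP cN] DN.
(* [G - F] stands for [(M - N) * (p - q)], with negative terms moved across to avoid subtraction in
   [nat]. *)
pose F i j := N i j * p i + M i j * q j.
pose G i j := M i j * p i + N i j * q j.
have FG i j : F i j <= G i j ?= iff (N i j == M i j).
  rewrite /F /G; case: (boolP ((i, j, M i j) \in D)).
    by move/(subsetP DN); rewrite inE /= => /eqP->; rewrite eqxx; apply/leqifP.
  move/pot; case: (M i j) (N i j) => [] [] /= H;
  apply/leqifP; rewrite /= ?mul0n ?mul1n ?addn0 ?add0n //; lia.
have sumE : \sum_i \sum_j F i j = \sum_i \sum_j G i j.
  rewrite (eq_bigr (fun i => \sum_j N i j * p i + \sum_j M i j * q j)); last first.
    by move=> i _; rewrite big_split.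
  rewrite [RHS](eq_bigr (fun i => \sum_j M i j * p i + \sum_j N i j * q j)); last first.
    by move=> i _; rewrite big_split.
  rewrite !big_split /=; congr addn.
    by apply: eq_bigr => i _; rewrite -!big_distrl /=; congr muln; apply/eqP/rN.
  rewrite exchange_big [RHS]exchange_big /=; apply: eq_bigr => j _.
  by rewrite -!big_distrl /=; congr muln; apply/esym/eqP/cN.
have/leqif_sum FGs : forall i : 'I_m, true ->
    \sum_j F i j <= \sum_j G i j ?= iff [forall j, N i j == M i j].
  by move=> i _; apply: leqif_sum => j _; apply: FG.
move: (FGs) => [_]; rewrite sumE eqxx => /esym/forallP NM.
by apply/matrixP => i j; apply/eqP; have /forallP := NM i; apply.
Qed.

(** Without a potential, the arcs outside [D] contain disjoint cycles, and reversing these yields a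
    second matrix with the margins of [M] that still contains [D]. *)
Lemma defining_potential M D :
  defining_set M D -> exists p q, is_potential M D p q.
Proof.
case=> DM uniqM.
pose e (u v : 'I_m + 'I_n) := match u, v with
  | inl i, inr j => ((i, j, M i j) \notin D) && ~~ M i j
  | inr j, inl i => ((i, j, M i j) \notin D) && M i j
  | _, _ => false end.
case: (potential_or_no_sink e) => [[p pe]|[X X0 succX]].
  exists (p \o inl), (p \o inr) => i j ijD /=.
  by case: ifP => Mij; apply: pe; rewrite /= ijD Mij.
have [f [P [P0 fP finj eP]]] := successor_cycles X0 succX.
(* [A] marks the 1s and [B] the 0s of [M] whose arcs the cycles use; [N] flips exactly these
   cells. *)
pose A i j := (inr j \in P) && (f (inr j) == inl i).
pose B i j := (inl i \in P) && (f (inl i) == inr j).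
have AM i j : A i j -> ((i, j, M i j) \notin D) && M i j.
  by case/andP=> /eP + /eqP fE; rewrite fE.
have BM i j : B i j -> ((i, j, M i j) \notin D) && ~~ M i j.
  by case/andP=> /eP + /eqP fE; rewrite fE.
pose N : 'M[bool]_(m, n) := (\matrix_(i, j) ((M i j && ~~ A i j) || B i j))%R.
have NE i j : N i j + A i j = M i j + B i j.
  have /implyP : A i j -> M i j by case/AM/andP.
  have /implyP : B i j -> ~~ M i j by case/BM/andP.
  by rewrite mxE; case: (M i j) (A i j) (B i j) => [] [] [].
(* One cycle arc leaves and one enters each vertex of [P], so every row and column loses as many 1s
   as it gains. *)
have out_degree v : \sum_w ((v \in P) && (f v == w) : nat) = (v \in P).
  case: (v \in P) => /=; last by rewrite big1.
  by rewrite (@sum_pred_unique _ (f v)) // => u /eqP.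
have in_degree v : \sum_u ((u \in P) && (f u == v) : nat) = (v \in P).
  case: (boolP (v \in P)) => vP /=; last first.
    rewrite big1 // => u _; case: (boolP (u \in P)) => //= uP.
    by case: eqP => // fu; case/negP: vP; rewrite -fu -fP imset_f.
  have /imsetP[u uP vE] : v \in f @: P by rewrite fP.
  rewrite (@sum_pred_unique _ u) ?uP ?vE //=.
  by move=> w /andP[wP /eqP]; apply: finj.
have noLL i i' : (inl i \in P) && (f (inl i) == inl i') = false.
  by apply/negP=> /andP[/eP + /eqP fE]; rewrite fE.
have noRR j j' : (inr j \in P) && (f (inr j) == inr j') = false.
  by apply/negP=> /andP[/eP + /eqP fE]; rewrite fE.
have NM : N = M.
  apply: uniqM.
    rewrite inE; apply/andP; split; apply/forallP.
      move=> i; rewrite -(eqn_add2r (\sum_j A i j)) /row_sum -big_split /=.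
      rewrite (eq_bigr _ (fun j _ => NE i j)) big_split /= eqn_add2l.
      move: (out_degree (inl i)) (in_degree (inl i)); rewrite !big_sumType /=.
      rewrite [X in X + _]big1 => [|? _]; last by rewrite noLL.
      rewrite [X in _ -> X + _ = _ -> _]big1 => [|? _]; last by rewrite noLL.
      by rewrite !add0n => -> ->.
    move=> j; rewrite -(eqn_add2r (\sum_i A i j)) /col_sum -big_split /=.
    rewrite (eq_bigr _ (fun i _ => NE i j)) big_split /= eqn_add2l.
    move: (out_degree (inr j)) (in_degree (inr j)); rewrite !big_sumType /=.
    rewrite [X in _ + X]big1 => [|? _]; last by rewrite noRR.
    rewrite [X in _ -> _ + X = _ -> _]big1 => [|? _]; last by rewrite noRR.
    by rewrite !addn0 => -> ->.
  apply/subsetP=> -[[i j] b] ijD; move: (subsetP DM _ ijD).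
  rewrite !inE /= => /eqP ME; rewrite -ME in ijD *; rewrite mxE.
  move: (@AM i j) (@BM i j); rewrite ijD /=.
  by case: (A i j) => [/(_ isT)|_] //; case: (B i j) => [/(_ isT)|_] //;
     rewrite orbF andbT.
(* Any vertex of [P] supplies an arc, hence a cell at which [N] and [M] differ. *)
have /set0Pn[u uP] := P0; move: (eP u uP).
case: u uP => [i|j] uP; case fE: (f _) => [i'|j'] //= /andP[_ Me].
  have Bij : B i j' by rewrite /B uP fE eqxx.
  by move/matrixP: NM => /(_ i j'); rewrite mxE Bij orbT (negPf Me).
have Aij : A i' j by rewrite /A uP fE eqxx.
move/matrixP: NM => /(_ i' j); rewrite mxE Aij andbF Me /= => Bij.
by move: (BM _ _ Bij); rewrite Me andbF.
Qed.

(** A proper subset of [C] omits some [c], and a potential outside the subset is also one outside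
    the larger [C :\ c]; so testing the removal of single triples suffices. *)
Lemma critical_potentialP M C :
  critical_set M C <->
  [/\ C \subset triples M, exists p q, is_potential M C p q
    & forall c p q, c \in C -> ~ is_potential M (C :\ c) p q].
Proof.
split=> [[defC minC]|[CM [p [q pot]] minC]].
  split; first by case: defC.
    exact: defining_potential.
  move=> c p q cC pot; apply: (minC (C :\ c)); first by rewrite properD1.
  apply: potential_defining pot; apply: subset_trans (subsetDl _ _) _.
  by case: defC.
split; first exact: potential_defining pot.
move=> D /properP[DC [c cC cD]] /defining_potential[p' [q' pot']].
apply: (minC c p' q' cC) => i j ijN; apply: pot'; apply: contraNN ijN => ijD.
by rewrite !inE (subsetP DC) // andbT; apply: contraNneq cD => <-.
Qed.

End Potentials.

(** * Positions of steps and maximal runs in a walk *)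

Section StepTimes.
Variable W : seq step.
Implicit Types (s : step) (i k l : nat).

(** This is [walk_x] for East and [walk_d] for South, with the direction as a parameter. *)
Definition steps_before s k : nat := count_mem s (take k W).

Lemma steps_beforeS s k : k < size W ->
  steps_before s k.+1 = steps_before s k + (nth East W k == s).
Proof.
by move=> kW; rewrite /steps_before (take_nth East) // -cats1 count_cat /= addn0.
Qed.

Lemma steps_before_mono s k l : k <= l -> steps_before s k <= steps_before s l.
Proof.
move=> kl; rewrite /steps_before -[take k W](take_takel W kl).
by rewrite -[X in _ <= count_mem s X](cat_take_drop k) count_cat leq_addr.
Qed.

Lemma step_time_before s k : k < size W -> nth East W k = s ->
  step_time s W (steps_before s k) = k.
Proof.
move=> kW ks; rewrite /step_time.
have -> : iota 0 (size W) = iota 0 k ++ k :: iota k.+1 (size W - k.+1).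
  by rewrite -[in LHS](subnKC kW) addSnnS iotaD.
rewrite filter_cat /= ks eqxx nth_cat.
suff -> : size [seq x <- iota 0 k | nth East W x == s] = steps_before s k.
  by rewrite ltnn subnn.
rewrite size_filter /steps_before -(map_nth_iota0 East (ltnW kW)) count_map.
by apply: eq_count.
Qed.

Lemma steps_before_lt s k : k < size W -> nth East W k = s ->
  steps_before s k < count_mem s W.
Proof.
move=> kW ks; have := steps_before_mono s kW.
by rewrite steps_beforeS // ks eqxx addn1 /steps_before take_size.
Qed.

Lemma step_timeP s i : i < count_mem s W ->
  [/\ step_time s W i < size W, nth East W (step_time s W i) = s
    & steps_before s (step_time s W i) = i].
Proof.
move=> iW; set L := [seq k <- iota 0 (size W) | nth East W k == s].
have sL : size L = count_mem s W.
  rewrite size_filter -[in RHS](mkseq_nth East W) count_map.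
  by apply: eq_count.
have : step_time s W i \in L by apply: mem_nth; rewrite sL.
rewrite mem_filter mem_iota => /andP[/eqP ks /= kW]; split=> //.
apply/eqP; rewrite -(@nth_uniq _ (size W) L) ?sL //.
- by apply/eqP; apply: step_time_before.
- exact: steps_before_lt.
- exact/filter_uniq/iota_uniq.
Qed.

(** Times and counts are adjoint, which turns statements about lattice coordinates into comparisons
    of positions in [W]. *)
Lemma step_time_lt s i k : i < count_mem s W ->
  (step_time s W i < k) = (i < steps_before s k).
Proof.
move=> iW; have [tW ts tE] := step_timeP iW; apply/idP/idP => [tk|].
  by have := steps_before_mono s tk; rewrite steps_beforeS // ts eqxx tE addn1.
by apply: contraTT; rewrite -!leqNgt => /(steps_before_mono s); rewrite tE.
Qed.

Lemma no_step_between s k l : l <= size W ->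
  steps_before s k = steps_before s l -> forall t, k <= t < l -> nth East W t <> s.
Proof.
move=> lW kl t /andP[kt tl] ts.
have := steps_before_mono s kt; have := steps_before_mono s tl.
by rewrite steps_beforeS ?ts ?eqxx; lia.
Qed.

(** If no [s] occurs strictly between [k] and [l], the first run ends right after [k] and maximality
    extends the second one back to that point; if no [~~ s] occurs there, the first run extends up
    to [l], where the second begins. *)
Lemma runs_adjacent s k l a b a' b' :
  max_run s W a b -> max_run (~~ s) W a' b' ->
  a <= k < b -> a' <= l < b' -> k < l ->
  (forall t, k < t < l -> nth East W t <> s) \/
  (forall t, k < t < l -> nth East W t <> ~~ s) ->
  b = a'.
Proof.
case=> abW ab _ bmax [abW' ab' amax _] kab lab kl.
have nk := ab k kab; have nl := ab' l lab.
have k_a' : k < a'.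
  rewrite ltnNge; apply/negP=> a'k; have := ab' k; rewrite nk.
  by case: (s) => H; have/H : a' <= k < b' by lia.
have b_l : b <= l.
  rewrite leqNgt; apply/negP=> lb; have := ab l; rewrite nl.
  by case: (s) => H; have/H : a <= l < b by lia.
case=> no.
  have -> : b = k.+1.
    apply/eqP; rewrite eqn_leq; apply/andP; split; last lia.
    rewrite leqNgt; apply/negP=> kb; apply: (no k.+1); last by apply: ab; lia.
    rewrite ltnSn /= ltn_neqAle kl andbT; lia.
  apply/eqP; rewrite eqn_leq k_a' /= leqNgt; apply/negP=> ka'.
  apply: amax; first lia.
  have := no a'.-1; have : k < a'.-1 < l by lia.
  by move=> /[swap] /[apply]; case: (s) (nth _ _ _) => [] [].
have -> : a' = l.
  apply/eqP; rewrite eqn_leq; apply/andP; split; first lia.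
  rewrite leqNgt; apply/negP=> kb; apply: (no l.-1); first lia.
  by apply: ab'; lia.
apply/eqP; rewrite eqn_leq b_l /= leqNgt; apply/negP=> bl.
apply: bmax; first lia.
have := no b; have : k < b < l by lia.
by move=> /[swap] /[apply]; case: (s) (nth _ _ _) => [] [].
Qed.

Lemma max_run_left s k b : k < b <= size W ->
  (forall t, k <= t < b -> nth East W t = s) ->
  (b < size W -> nth East W b <> s) ->
  exists2 a, a <= k & max_run s W a b.
Proof.
move=> kb ks bmax.
pose P a := (a <= k) && [forall t : 'I_b, (a <= t) ==> (nth East W t == s)].
have exP : exists a, P a.
  exists k; rewrite /P leqnn; apply/forallP=> t; apply/implyP=> kt.
  by apply/eqP/ks; rewrite kt /=.
case: (ex_minnP exP) => a /andP[ak /forallP Pa] amin.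
exists a => //; split=> //; first lia.
  move=> t /andP[at_ tb]; apply/eqP.
  by have := Pa (Ordinal tb); rewrite /= at_.
move=> a0 as_; suff /amin : P a.-1 by lia.
rewrite /P; apply/andP; split; first lia.
apply/forallP=> t; apply/implyP=> at_.
case: (ltngtP a.-1 t) at_ => // [lt_at|<-] _; last exact/eqP.
by have /implyP := Pa t; apply; lia.
Qed.

Lemma max_run_right s b l : b <= l < size W ->
  (forall t, b <= t <= l -> nth East W t = s) ->
  (0 < b -> nth East W b.-1 <> s) ->
  exists2 d, l < d & max_run s W b d.
Proof.
move=> bl ls bmax.
pose P d := (l < d <= size W) &&
  [forall t : 'I_(size W), (b <= t < d) ==> (nth East W t == s)].
have exP : exists d, P d.
  exists l.+1; rewrite /P; apply/andP; split; first lia.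
  apply/forallP=> t; apply/implyP=> kt; apply/eqP/ls; lia.
have ubP d : P d -> d <= size W by case/andP=> /andP[].
case: (ex_maxnP exP ubP) => d /andP[/andP[ld dW] /forallP Pd] dmax.
exists d => //; split=> //; first lia.
  move=> t /andP[bt td]; apply/eqP.
  by have := Pd (Ordinal (leq_trans td dW)); rewrite /= bt td.
move=> dlt ds; suff /dmax : P d.+1 by lia.
rewrite /P; apply/andP; split; first lia.
apply/forallP=> t; apply/implyP=> /andP[bt td].
move: td; rewrite ltnS leq_eqVlt => /orP[/eqP-> |td]; first exact/eqP.
by have /implyP := Pd t; apply; lia.
Qed.

(* Either the steps from [k] to [l] form two consecutive runs, or there are
   [k < c < d < l] with steps [c] and [l] equal and steps [d] and [k] equal. *)
Lemma alternating_chain (P : nat -> nat) :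
  (forall s k b l, k < b <= l -> l < size W ->
    (forall t, k <= t < b -> nth East W t = s) ->
    (forall t, b <= t <= l -> nth East W t = ~~ s) -> P k < P l) ->
  forall k l, k < l < size W -> nth East W k <> nth East W l -> P k < P l.
Proof.
move=> adj k l; have [h] := ubnP (l - k); elim: h k l => // h IH k l lk kl ne.
set s := nth East W k in ne.
have nl : nth East W l = ~~ s by case: (s) (nth _ _ _) ne => [] [].
have exb : exists b, (k < b) && (nth East W b == ~~ s).
  by exists l; rewrite nl eqxx andbT; lia.
case: (ex_minnP exb) => b /andP[kb /eqP nb] bmin.
have bl : b <= l by apply: bmin; rewrite nl eqxx andbT; lia.
case: (boolP [forall t : 'I_l, (b <= t) ==> (nth East W t == ~~ s)]).
  move=> /forallP allt; apply: (adj s k b l); try lia.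
    move=> t tkb; case: (eqVneq t k) => [-> //|tk].
    case: (eqVneq (nth East W t) s) => // nt; suff : b <= t by lia.
    apply: bmin; apply/andP; split; first lia.
    by case: (s) (nth _ _ _) nt => [] [].
  move=> t tbl; case: (eqVneq t l) => [-> //|tl].
  have tl' : t < l by lia.
  have := allt (Ordinal tl') => /=; case: (b <= t) tbl => //= _ /eqP //.
rewrite negb_forall => /existsP[d]; rewrite negb_imply => /andP[bd nd].
have {}nd : nth East W d = s by case: (s) (nth _ _ _) nd => [] [].
have dl := ltn_ord d.
have bd' : b < d.
  by rewrite ltn_neqAle bd andbT; apply/eqP=> bdE; move: nd; rewrite -bdE nb; case: (s).
have k1 : P k < P b by apply: IH; rewrite ?nb -/s; [lia|lia|case: (s)].
have k2 : P b < P d by apply: IH; rewrite ?nb ?nd; [lia|lia|case: (s)].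
have k3 : P d < P l by apply: IH; rewrite ?nl ?nd; [lia|lia|case: (s)].
lia.
Qed.

End StepTimes.

(** * Rows, columns and bordering blocks of a walk *)

Section Walks.
Variables (m n : nat) (W : seq step).
Hypothesis walkW : is_walk m n W.
Implicit Types (M : 'M[bool]_(m, n)) (C : {set 'I_m * 'I_n * bool}).
Implicit Types (i : 'I_m) (j : 'I_n) (B : {set 'I_m * 'I_n}).

Definition row_time i : nat := step_time South W i.
Definition col_time j : nat := step_time East W j.

Lemma row_timeP i : [/\ row_time i < size W, nth East W (row_time i) = South
  & steps_before W South (row_time i) = i].
Proof. by apply: step_timeP; rewrite (proj2 walkW). Qed.

Lemma col_timeP j : [/\ col_time j < size W, nth East W (col_time j) = East
  & steps_before W East (col_time j) = j].
Proof. by apply: step_timeP; rewrite (proj1 walkW). Qed.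

Lemma row_time_inj : injective row_time.
Proof.
move=> i i' e; apply: val_inj; have [_ _ /= <-] := row_timeP i.
by have [_ _ <-] := row_timeP i'; rewrite e.
Qed.

Lemma col_time_inj : injective col_time.
Proof.
move=> j j' e; apply: val_inj; have [_ _ /= <-] := col_timeP j.
by have [_ _ <-] := col_timeP j'; rewrite e.
Qed.

Lemma time_neq i j : row_time i <> col_time j.
Proof.
by have [_ + _] := row_timeP i; have [_ + _] := col_timeP j => + + e; rewrite e => ->.
Qed.

Lemma row_timeE k : k < size W -> nth East W k = South ->
  exists2 i, row_time i = k & i = steps_before W South k :> nat.
Proof.
move=> kW ks; have := steps_before_lt kW ks; rewrite (proj2 walkW) => lt_m.
by exists (Ordinal lt_m) => //; apply: step_time_before.
Qed.

Lemma col_timeE k : k < size W -> nth East W k = East ->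
  exists2 j, col_time j = k & j = steps_before W East k :> nat.
Proof.
move=> kW ks; have := steps_before_lt kW ks; rewrite (proj1 walkW) => lt_n.
by exists (Ordinal lt_n) => //; apply: step_time_before.
Qed.

Lemma row_time_lt i k : (row_time i < k) = (i < steps_before W South k).
Proof. by apply: step_time_lt; rewrite (proj2 walkW). Qed.

Lemma col_time_lt j k : (col_time j < k) = (j < steps_before W East k).
Proof. by apply: step_time_lt; rewrite (proj1 walkW). Qed.

(** The x-coordinate of the South step of row [i] counts the East steps before it, so it exceeds [j]
    once column [j] has been crossed. Hence 1s below [W] are forward arcs. *)
Lemma belowE i j : ((i, j) \in below W) = (col_time j < row_time i).
Proof. by rewrite inE /= col_time_lt. Qed.

Lemma aboveE i j : ((i, j) \in above W) = (row_time i < col_time j).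
Proof.
rewrite in_setC belowE -leqNgt leq_eqVlt.
by case: eqP => // /time_neq.
Qed.

(** The shared segment is a side of a cell of the block; comparing coordinates, the step along it
    crosses the row or the column of that cell. *)
Lemma meets_walkP B : meets_walk W B -> exists i j, (i, j) \in B /\
  (j <= steps_before W East (row_time i) <= j.+1 \/
   i <= steps_before W South (col_time j) <= i.+1).
Proof.
case=> e /mapP[k]; rewrite mem_iota /= => kW -> /cards1P[[i j] cB].
have : (i, j) \in [set (i, j)] by rewrite inE.
rewrite -cB inE => /andP[ijB]; rewrite /sides !inE !xpair_eqE /=.
rewrite -[walk_x W k]/(steps_before W East k) -[walk_d W k]/(steps_before W South k).
move=> sij; exists i, j; split=> //.
have [kE|kS] : nth East W k = East \/ nth East W k = South.
  by case: (nth East W k); [left|right].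
- have [j' j'k j'E] := col_timeE kW kE; rewrite kE /= -j'E in sij.
  have <- : j' = j by apply: val_inj => /=; lia.
  by right; rewrite j'k; lia.
- have [i' i'k i'E] := row_timeE kW kS; rewrite kS /= -i'E in sij.
  have <- : i' = i by apply: val_inj => /=; lia.
  by left; rewrite i'k; lia.
Qed.

(** Contact with [W] makes the two runs of the block consecutive, East then South, and [b] is the
    time of the turn. That no column occurs from [b] to row [i], and no row from column [j] to [b],
    is what permits moving both next to the turn. *)
Lemma borders_from_below_times B i j : borders_from_below W B -> (i, j) \in B ->
  exists2 b, col_time j < b <= row_time i &
    (forall j', ~~ (b <= col_time j' <= row_time i)) /\
    (forall i', ~~ (col_time j <= row_time i' < b)).
Proof.
case=> [[a [b [a' [b' [runS runE ->]]]]] Bb /meets_walkP[i0 [j0 [ijB0 meet]]]] ijB.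
have := subsetP Bb _ ijB0; rewrite belowE => lt0.
move: ijB ijB0; rewrite !inE /= => /andP[iab jab] /andP[iab0 jab0].
have [iW _ iE] := row_timeP i0; have [jW _ jE] := col_timeP j0.
have /(runs_adjacent runE runS jab0 iab0 lt0) adj :
    (forall t, col_time j0 < t < row_time i0 -> nth East W t <> East) \/
    (forall t, col_time j0 < t < row_time i0 -> nth East W t <> South).
  (* Contact along a South step leaves no further East step between the column and the row; contact
     along an East step leaves no further South step. *)
  case: meet => meet; [left|right].
    move: (lt0); rewrite col_time_lt => lt0'.
    apply: (@no_step_between W East (col_time j0).+1) (ltnW iW) _.
    by rewrite steps_beforeS // jE; have [_ -> _] := col_timeP j0; lia.
  have : ~~ (row_time i0 < col_time j0) by lia.
  rewrite row_time_lt => lt0'.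
  move=> t ?; apply: (@no_step_between W South (col_time j0) (row_time i0)) => //; last lia.
    exact: ltnW.
  by rewrite iE; lia.
exists b'; first by rewrite /col_time /row_time; lia.
have [_ allS _ _] := runS; have [_ allE _ _] := runE.
split=> [j'|i']; apply/negP=> H.
  have /allS : a <= col_time j' < b by rewrite /col_time /row_time in H jab iab *; lia.
  by have [_ -> _] := col_timeP j'.
have /allE : a' <= row_time i' < b' by rewrite /col_time /row_time in H jab iab *; lia.
by have [_ -> _] := row_timeP i'.
Qed.

(** Rows and columns exchange roles: the runs are South, then East. *)
Lemma borders_from_above_times B i j : borders_from_above W B -> (i, j) \in B ->
  exists2 b, row_time i < b <= col_time j &
    (forall i', ~~ (b <= row_time i' <= col_time j)) /\
    (forall j', ~~ (row_time i <= col_time j' < b)).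
Proof.
case=> [[a [b [a' [b' [runS runE ->]]]]] Bb /meets_walkP[i0 [j0 [ijB0 meet]]]] ijB.
have := subsetP Bb _ ijB0; rewrite aboveE => lt0.
move: ijB ijB0; rewrite !inE /= => /andP[iab jab] /andP[iab0 jab0].
have [iW _ iE] := row_timeP i0; have [jW _ jE] := col_timeP j0.
have adj : b = a'.
  apply: (runs_adjacent runS runE iab0 jab0 lt0).
  rewrite -/(row_time i0) -/(col_time j0); case: meet => meet; [right|left].
    have : ~~ (col_time j0 < row_time i0) by lia.
    rewrite col_time_lt => lt0'.
    move=> t ?; apply: (@no_step_between W East (row_time i0) (col_time j0)) => //; last lia.
      exact: ltnW.
    by rewrite jE; lia.
  move: (lt0); rewrite row_time_lt => lt0'.
  apply: (@no_step_between W South (row_time i0).+1) (ltnW jW) _.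
  by rewrite steps_beforeS // iE; have [_ -> _] := row_timeP i0; lia.
exists b; first by rewrite /col_time /row_time; lia.
have [_ allS _ _] := runS; have [_ allE _ _] := runE.
split=> [i'|j']; apply/negP=> H.
  have /allE : a' <= row_time i' < b' by rewrite /col_time /row_time in H jab iab *; lia.
  by have [_ -> _] := row_timeP i'.
have /allS : a <= col_time j' < b by rewrite /col_time /row_time in H jab iab *; lia.
by have [_ -> _] := col_timeP j'.
Qed.

Lemma runs_border_below a b d :
  max_run East W a b -> max_run South W b d ->
  borders_from_below W (setX [set i : 'I_m | b <= step_time South W i < d]
                             [set j : 'I_n | a <= step_time East W j < b]).
Proof.
move=> runE runS; have [ab allE _ _] := runE; have [bd allS _ _] := runS.
split; first by exists b, d, a, b.
  apply/subsetP=> -[i j]; rewrite belowE !inE /= /col_time /row_time; lia.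
have bW : b < size W by lia.
have bS : nth East W b = South by apply: allS; lia.
have [i0 i0b i0E] := row_timeE bW bS.
have b1E : nth East W b.-1 = East by apply: allE; lia.
have b1W : b.-1 < size W by lia.
have [j0 j0b j0E] := col_timeE b1W b1E.
have xE : steps_before W East b = j0.+1.
  by rewrite -[b in LHS](@prednK b) ?steps_beforeS ?b1E -?j0E ?addn1 //; lia.
(* The South step at time [b] is the right side of [(i0, j0)], the cell of the block at the turn.
   The only other cell with this side is in the next column, which is not crossed before [b] and so
   misses the block. *)
exists (South, j0.+1, nat_of_ord i0).
  by apply/mapP; exists b; rewrite ?mem_iota // -xE i0E bS.
apply/cards1P; exists (i0, j0); apply/setP=> -[i j].
rewrite !inE !xpair_eqE /= -!(inj_eq val_inj) /= eqSS [i0 == i :> nat]eq_sym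
        [j0 == j :> nat]eq_sym !orbF.
rewrite -/(row_time i) -/(col_time j).
case: (eqVneq (i : nat) i0) => [/val_inj->|]; last by rewrite !andbF.
rewrite !andbT i0b; case: (eqVneq (j : nat) j0) => [/val_inj->|jj].
  by rewrite j0b orbT; lia.
rewrite orbF; apply/negP=> /andP[/andP[_ /andP[_ jb]] /eqP jE].
by rewrite col_time_lt xE -jE ltnn in jb.
Qed.

Lemma runs_border_above a b d :
  max_run South W a b -> max_run East W b d ->
  borders_from_above W (setX [set i : 'I_m | a <= step_time South W i < b]
                             [set j : 'I_n | b <= step_time East W j < d]).
Proof.
move=> runS runE; have [ab allS _ _] := runS; have [bd allE _ _] := runE.
split; first by exists a, b, b, d.
  apply/subsetP=> -[i j]; rewrite aboveE !inE /= /col_time /row_time; lia.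
have bW : b < size W by lia.
have bE : nth East W b = East by apply: allE; lia.
have [j0 j0b j0E] := col_timeE bW bE.
have b1S : nth East W b.-1 = South by apply: allS; lia.
have b1W : b.-1 < size W by lia.
have [i0 i0b i0E] := row_timeE b1W b1S.
have xE : steps_before W South b = i0.+1.
  by rewrite -[b in LHS](@prednK b) ?steps_beforeS ?b1S -?i0E ?addn1 //; lia.
(* Here the East step at time [b] is the bottom side of the cell at the turn; the row under it is
   not crossed before [b]. *)
exists (East, nat_of_ord j0, i0.+1).
  by apply/mapP; exists b; rewrite ?mem_iota // -xE j0E bE.
apply/cards1P; exists (i0, j0); apply/setP=> -[i j].
rewrite !inE !xpair_eqE /= -!(inj_eq val_inj) /= eqSS [i0 == i :> nat]eq_sym
        [j0 == j :> nat]eq_sym.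
rewrite -/(row_time i) -/(col_time j).
case: (eqVneq (j : nat) j0) => [/val_inj->|]; last by rewrite !andbF.
rewrite !andbT j0b; case: (eqVneq (i : nat) i0) => [/val_inj->|jj].
  by rewrite i0b orbT; lia.
rewrite orbF; apply/negP=> /andP[/andP[/andP[_ ib] _] /eqP iE].
by rewrite row_time_lt xE -iE ltnn in ib.
Qed.

End Walks.

(** * Critical sets and walks *)

Section Criticality.
Variables m n : nat.
Implicit Types (M : 'M[bool]_(m, n)) (C : {set 'I_m * 'I_n * bool}).

Lemma occupiedE M C i j :
  C \subset triples M -> occupied C (i, j) = ((i, j, M i j) \in C).
Proof.
move=> CM; apply/existsP/idP => [[b /= ijC]|ijC]; last by exists (M i j).
by have := subsetP CM _ ijC; rewrite inE /= => /eqP->.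
Qed.

(** The first two clauses make [C] the set of backward arcs for the order of the steps of [W]; the
    last two make all arcs between consecutive runs forward. *)
Definition agrees_off_blocks W M C : Prop :=
  [/\ (forall c : 'I_m * 'I_n, ~~ occupied C c ->
         (c \in below W -> M c.1 c.2 = true) /\
         (c \in above W -> M c.1 c.2 = false)),
      (forall c : 'I_m * 'I_n, occupied C c ->
         (c \in below W -> M c.1 c.2 = false) /\
         (c \in above W -> M c.1 c.2 = true)),
      (forall B : {set 'I_m * 'I_n}, borders_from_below W B ->
         forall c, c \in B -> M c.1 c.2 = true)
    & (forall B : {set 'I_m * 'I_n}, borders_from_above W B ->
         forall c, c \in B -> M c.1 c.2 = false)].

(** Step times are a potential outside [C]. Any such potential is forced, through consecutive runs,
    to increase from each step to every later step of the other direction, so no backward arc can be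
    released from [C]. *)
Lemma walk_critical W M C : is_walk m n W -> C \subset triples M ->
  agrees_off_blocks W M C -> critical_set M C.
Proof.
move=> walkW CM [free occ blockb blocka]; apply/critical_potentialP; split=> //.
  exists (row_time W), (col_time W) => i j; rewrite -(occupiedE _ _ CM) => /free[/=].
  rewrite belowE // aboveE // => Mb Ma.
  have := @time_neq _ _ _ walkW i j.
  case: (ltngtP (row_time W i) (col_time W j)) Mb Ma => // lt_ij.
    by move=> _ ->.
  by move=> ->.
move=> c p q cC pot.
(* Each time in [W] belongs to exactly one row or column, whose potential [P] returns. *)
pose P k := \sum_(i | row_time W i == k) p i + \sum_(j | col_time W j == k) q j.
have Prow i : P (row_time W i) = p i.
  rewrite /P (big_pred1 i) => [|i']; last by rewrite /= (inj_eq (row_time_inj walkW)).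
  by rewrite big1 ?addn0 // => j /eqP/esym/(time_neq walkW).
have Pcol j : P (col_time W j) = q j.
  rewrite /P [X in _ + X](big_pred1 j) => [|j']; last by rewrite /= (inj_eq (col_time_inj walkW)).
  by rewrite big1 // => i /eqP/(time_neq walkW).
have free_pot i j : (i, j, M i j) \notin C -> if M i j then q j < p i else p i < q j.
  by move=> ijC; apply: pot; rewrite inE negb_and ijC orbT.
have mono : forall k l, k < l < size W -> nth East W k <> nth East W l -> P k < P l.
  apply: alternating_chain => s k b l kbl lW ks ls.
  have kW : k < size W by lia.
  have nk : nth East W k = s by apply: ks; lia.
  have nl : nth East W l = ~~ s by apply: ls; lia.
  have nb : nth East W b = ~~ s by apply: ls; lia.
  have nb1 : nth East W b.-1 = s by apply: ks; lia.
  have [a ak runa] : exists2 a, a <= k & max_run s W a b.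
    apply: max_run_left => //; first lia.
    by rewrite nb; case: (s).
  have [d ld rund] : exists2 d, l < d & max_run (~~ s) W b d.
    apply: max_run_right => //; first lia.
    by rewrite nb1; case: (s).
  case: s nk nl runa rund {ks ls nb nb1} => /= nk nl runa rund.
    have [j jk _] := col_timeE walkW kW nk; have [i il _] := row_timeE walkW lW nl.
    have ijB : (i, j) \in setX [set i : 'I_m | b <= step_time South W i < d]
                             [set j : 'I_n | a <= step_time East W j < b].
      by rewrite !inE /= -/(row_time W i) -/(col_time W j) il jk; lia.
    have /= Mij := blockb _ (runs_border_below walkW runa rund) _ ijB.
    rewrite -il -jk Prow Pcol; have := @free_pot i j; rewrite Mij; apply.
    rewrite -Mij -(occupiedE _ _ CM); apply/negP=> /occ[+ _] /=.
    by rewrite belowE // il jk Mij => /(_ _)/negP; case; lia.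
  have [i ik _] := row_timeE walkW kW nk; have [j jl _] := col_timeE walkW lW nl.
  have ijB : (i, j) \in setX [set i : 'I_m | a <= step_time South W i < b]
                             [set j : 'I_n | b <= step_time East W j < d].
    by rewrite !inE /= -/(row_time W i) -/(col_time W j) ik jl; lia.
  have /= Mij := blocka _ (runs_border_above walkW runa rund) _ ijB.
  rewrite -ik -jl Prow Pcol; have := @free_pot i j; rewrite Mij; apply.
  rewrite -Mij -(occupiedE _ _ CM); apply/negP=> /occ[_ +] /=.
  by rewrite aboveE // ik jl Mij => /(_ _)/negP; case; lia.
(* The arc of the removed triple goes backward in [W], yet the potential would increase along it. *)
case: c cC pot => [[i j] b] cC pot.
have bE : M i j = b by have := subsetP CM _ cC; rewrite inE => /eqP.
have := pot i j; rewrite bE !inE eqxx /= => /(_ isT).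
have : occupied C (i, j) by rewrite (occupiedE _ _ CM) bE.
move/occ => /= []; rewrite belowE // aboveE // bE => Mb Ma.
have [iW iS _] := row_timeP walkW i; have [jW jE _] := col_timeP walkW j.
have := @time_neq _ _ _ walkW i j.
case: (ltngtP (row_time W i) (col_time W j)) Mb Ma => // lt_ij.
  move=> _ -> // _; have := mono (row_time W i) (col_time W j).
  rewrite iS jE Prow Pcol lt_ij jW => /(_ isT) H; have : p i < q j by apply: H.
  by lia.
move=> -> // _ _; have := mono (col_time W j) (row_time W i).
rewrite iS jE Prow Pcol lt_ij iW => /(_ isT) H; have : q j < p i by apply: H.
by lia.
Qed.

(** Minimality is used against a forward arc in [C] and, after a local rearrangement of times,
    against a backward arc in a bordering block. *)
Lemma critical_walk W M C p q : is_walk m n W -> critical_set M C ->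
  is_potential M C p q ->
  (forall i j, (col_time W j < row_time W i -> q j <= p i) /\
               (row_time W i < col_time W j -> p i <= q j)) ->
  agrees_off_blocks W M C.
Proof.
move=> walkW /critical_potentialP[CM _ minC] potpq sorted.
(* [sorted] gives weak inequalities only, but [p] and [q] are strict along arcs outside [C], so
   times order the ends the same way. *)
have pot : is_potential M C (row_time W) (col_time W).
  move=> i j /potpq; have [pb pa] := sorted i j.
  have := @time_neq _ _ _ walkW i j.
  by case: (ltngtP (row_time W i)) pb pa => // _ pb pa _; case: (M i j) => //; lia.
(* A forward arc could leave [C] with the step times still a potential. *)
have occ i j : (i, j, M i j) \in C ->
    M i j = (row_time W i < col_time W j).
  move=> ijC; apply: contraPeq (ijC) => Mij /(minC _ (row_time W) (col_time W)); apply.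
  move=> i' j'; rewrite !inE negb_and negbK => /orP[/eqP[-> -> _]|/pot //].
  have := @time_neq _ _ _ walkW i j.
  by case: (ltngtP (row_time W i)) Mij; case: (M i j).
have free i j : (i, j, M i j) \notin C ->
    M i j = (col_time W j < row_time W i).
  by move/pot; case: (M i j) => [->//|]; case: ltngtP.
split=> [[i j]|[i j]|B Bb [i j] ijB|B Ba [i j] ijB] /=.
- rewrite (occupiedE _ _ CM) belowE // aboveE // => /free->.
  by case: ltngtP.
- rewrite (occupiedE _ _ CM) belowE // aboveE // => /occ->.
  by case: ltngtP.
- have [b jbi [noj noi]] := borders_from_below_times walkW Bb ijB.
  case: (boolP ((i, j, M i j) \in C)) => [ijC|/free->]; last by lia.
  have Mij : M i j = false by rewrite occ //; lia.
  (* Column j moves to the end of its run, row i to the start of the next one,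
     and the two are swapped; truncated subtraction is harmless as 0 < b. *)
  pose p' i' := if i' == i then 4 * b - 3 else 4 * row_time W i'.
  pose q' j' := if j' == j then 4 * b - 2 else 4 * col_time W j'.
  case: (minC (i, j, M i j) p' q' ijC) => i' j'.
  rewrite !inE negb_and negbK => /orP[/eqP[-> -> _]|/pot].
    by rewrite Mij /p' /q' !eqxx; lia.
  rewrite /p' /q'; case: (eqVneq i' i) => [->|ii]; case: (eqVneq j' j) => [->|jj] //.
  + by rewrite Mij; lia.
  + by have := noj j'; case: (M i j') => H; lia.
  + by have := noi i'; case: (M i' j) => H; lia.
  + by case: (M i' j') => H; lia.
- have [b jbi [noi noj]] := borders_from_above_times walkW Ba ijB.
  case: (boolP ((i, j, M i j) \in C)) => [ijC|/free->]; last by lia.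
  have Mij : M i j = true by rewrite occ //; lia.
  (* Now row [i] ends its run and column [j] starts the next. The values [4 * b - 3 < 4 * b - 2] fit
     strictly between [4 * (b - 1)] and [4 * b], that is, between the two runs. *)
  pose p' i' := if i' == i then 4 * b - 2 else 4 * row_time W i'.
  pose q' j' := if j' == j then 4 * b - 3 else 4 * col_time W j'.
  case: (minC (i, j, M i j) p' q' ijC) => i' j'.
  rewrite !inE negb_and negbK => /orP[/eqP[-> -> _]|/pot].
    by rewrite Mij /p' /q' !eqxx; lia.
  rewrite /p' /q'; case: (eqVneq i' i) => [->|ii]; case: (eqVneq j' j) => [->|jj] //.
  + by rewrite Mij; lia.
  + by have := noj j'; case: (M i j') => H; lia.
  + by have := noi i'; case: (M i' j) => H; lia.
  + by case: (M i' j') => H; lia.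
Qed.

(** * Permuting rows and columns *)

Lemma permute_mxK s t M : permute_mx s^-1 t^-1 (permute_mx s t M) = M.
Proof. by apply/matrixP=> i j; rewrite !mxE !permKV. Qed.

Lemma permute_triples_sub s t M C :
  C \subset triples M -> permute_triples s t C \subset triples (permute_mx s t M).
Proof.
move=> CM; apply/subsetP=> -[[i j] b]; rewrite inE => /(subsetP CM).
by rewrite !inE /= !mxE.
Qed.

Lemma is_potential_permute s t M C p q : is_potential M C p q ->
  is_potential (permute_mx s t M) (permute_triples s t C) (p \o s) (q \o t).
Proof. by move=> pot i j; rewrite inE !mxE /= => /pot. Qed.

Lemma critical_set_permute s t M C : critical_set M C ->
  critical_set (permute_mx s t M) (permute_triples s t C).
Proof.
move=> /critical_potentialP[CM [p [q pot]] minC]; apply/critical_potentialP.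
split; first exact: permute_triples_sub.
  by exists (p \o s), (q \o t); apply: is_potential_permute.
move=> [[i j] b] p' q'; rewrite inE /= => cC.
move/(is_potential_permute (s := (s^-1)%g) (t := (t^-1)%g)); rewrite permute_mxK.
have -> : permute_triples s^-1 t^-1 (permute_triples s t C :\ (i, j, b))
          = C :\ (s i, t j, b).
  apply/setP=> -[[i' j'] b']; rewrite !inE /= !permKV.
  by rewrite !xpair_eqE !(canF_eq (permKV _)) .
exact: minC.
Qed.

End Criticality.

(** * A walk obtained by sorting potential values *)

Lemma nth_pmap_count (A B : Type) (f : A -> option B) (L : seq A) a0 b0 b k :
  k < size L -> f (nth a0 L k) = Some b -> nth b0 (pmap f L) (count f (take k L)) = b.
Proof.
move=> kL fb; rewrite -{1}[L](cat_take_drop k) (drop_nth a0) // pmap_cat /= fb /=.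
by rewrite nth_cat size_pmap ltnn subnn.
Qed.

Lemma nth_perm_exists (d : nat) (r : seq 'I_d) : uniq r -> size r = d ->
  exists s : 'S_d, forall i j : 'I_d, s i = nth j r i.
Proof.
move=> ur sr; have inj : injective (fun i : 'I_d => nth i r i).
  move=> i j; rewrite (set_nth_default i j) ?sr // => /eqP.
  by rewrite nth_uniq ?sr // => /eqP/val_inj.
by exists (perm inj) => i j; rewrite permE; apply: set_nth_default; rewrite sr.
Qed.

(** Rows and columns are sorted together by value and read as South and East steps; [s] and [t] list
    the rows and the columns in order of appearance. Ties are harmless, the inequalities being
    weak. *)
Lemma sorted_walk (m n : nat) (p : 'I_m -> nat) (q : 'I_n -> nat) :
  exists (s : 'S_m) (t : 'S_n) W, is_walk m n W /\
    forall i j, (col_time W j < row_time W i -> q (t j) <= p (s i)) /\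
                (row_time W i < col_time W j -> p (s i) <= q (t j)).
Proof.
pose V := ('I_m + 'I_n)%type.
pose w (v : V) := match v with inl i => p i | inr j => q j end.
pose row (v : V) := if v is inl i then Some i else None.
pose col (v : V) := if v is inr j then Some j else None.
pose le u v := w u <= w v.
pose L0 : seq V := map inl (enum 'I_m) ++ map inr (enum 'I_n).
pose L := sort le L0.
have inl_inj : injective (@inl 'I_m 'I_n) by move=> ? ? [].
have inr_inj : injective (@inr 'I_m 'I_n) by move=> ? ? [].
have uL : uniq L.
  rewrite sort_uniq cat_uniq !(map_inj_uniq inl_inj) (map_inj_uniq inr_inj).
  by rewrite !enum_uniq andbT /=; apply/hasPn=> _ /mapP[j _ ->]; apply/mapP=> -[].
have cL a : count a L = count (a \o inl) (enum 'I_m) + count (a \o inr) (enum 'I_n).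
  by rewrite count_sort count_cat !count_map.
have crow : count row L = m.
  by rewrite cL (eq_count (a2 := predT)) // count_predT size_enum_ord
             (eq_count (a2 := pred0)) // count_pred0 addn0.
have ccol : count col L = n.
  by rewrite cL (eq_count (a2 := pred0)) // count_pred0
             (eq_count (a2 := predT)) // count_predT size_enum_ord.
have [s sE] : exists s : 'S_m, forall i j : 'I_m, s i = nth j (pmap row L) i.
  apply: nth_perm_exists; last by rewrite size_pmap.
  by apply: (@pmap_uniq _ _ row inl); [case|].
have [t tE] : exists t : 'S_n, forall i j : 'I_n, t i = nth j (pmap col L) i.
  apply: nth_perm_exists; last by rewrite size_pmap.
  by apply: (@pmap_uniq _ _ col inr); [case|].
pose W := [seq (col v : bool) | v <- L].
have cS l : count_mem South [seq (col v : bool) | v <- l] = count row l.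
  by rewrite count_map; apply: eq_count; case.
have cE l : count_mem East [seq (col v : bool) | v <- l] = count col l.
  by rewrite count_map; apply: eq_count; case.
have walkW : is_walk m n W by split; rewrite ?cS ?cE.
have sW : size W = size L by rewrite size_map.
(* The South step of row [i] is preceded by exactly [i] rows in [L], so its entry is row [s i]. *)
have rowL i v0 : nth v0 L (row_time W i) = inl (s i).
  have [kW kS kE] := row_timeP walkW i; rewrite sW in kW.
  have : nth East W (row_time W i) = col (nth v0 L (row_time W i)) by rewrite (nth_map v0).
  rewrite kS; case vE : (nth v0 L _) => [i'|//] _; congr inl.
  rewrite (sE i i) -[in RHS]kE /steps_before -map_take cS.
  by apply/esym/(@nth_pmap_count _ _ _ _ v0); rewrite ?vE.
have colL j v0 : nth v0 L (col_time W j) = inr (t j).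
  have [kW kS kE] := col_timeP walkW j; rewrite sW in kW.
  have : nth East W (col_time W j) = col (nth v0 L (col_time W j)) by rewrite (nth_map v0).
  rewrite kS; case vE : (nth v0 L _) => [//|j'] _; congr inr.
  rewrite (tE j j) -[in RHS]kE /steps_before -map_take cE.
  by apply/esym/(@nth_pmap_count _ _ _ _ v0); rewrite ?vE.
have le_tr : transitive le by move=> ? ? ?; apply: leq_trans.
have Lsorted : sorted le L by apply: sort_sorted => ? ?; apply: leq_total.
exists s, t, W; split=> // i j.
have [iW _ _] := row_timeP walkW i; have [jW _ _] := col_timeP walkW j.
rewrite sW in iW jW; pose v0 : V := inl i.
split=> lt_ij; have := sorted_ltn_nth le_tr v0 Lsorted _ _ _ _ lt_ij;
  by rewrite rowL colL; apply.
Qed.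

Theorem theorem9 (m n : nat) (M : 'M[bool]_(m, n))
    (C : {set 'I_m * 'I_n * bool}) :
  critical_set M C <->
  C \subset triples M /\
  exists (s : 'S_m) (t : 'S_n) (W : seq step),
    let M' := permute_mx s t M in
    let C' := permute_triples s t C in
    [/\ is_walk m n W,
        (forall c : 'I_m * 'I_n, ~~ occupied C' c ->
           (c \in below W -> M' c.1 c.2 = true) /\
           (c \in above W -> M' c.1 c.2 = false)),
        (forall c : 'I_m * 'I_n, occupied C' c ->
           (c \in below W -> M' c.1 c.2 = false) /\
           (c \in above W -> M' c.1 c.2 = true)),
        (forall B : {set 'I_m * 'I_n}, borders_from_below W B ->
           forall c, c \in B -> M' c.1 c.2 = true)
      & (forall B : {set 'I_m * 'I_n}, borders_from_above W B ->
           forall c, c \in B -> M' c.1 c.2 = false)].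
Proof.
split=> [critC|[CM [s [t [W [walkW free occ blockb blocka]]]]]].
  have /critical_potentialP[CM [p [q pot]] _] := critC.
  split=> //; have [s [t [W [walkW sorted]]]] := sorted_walk p q.
  exists s, t, W.
  have [] := critical_walk walkW (critical_set_permute s t critC)
               (is_potential_permute (s := s) (t := t) pot) sorted.
  by split.
(* Criticality is shown for the permuted matrix and carried back by the inverse permutations. *)
have : critical_set (permute_mx s t M) (permute_triples s t C).
  by apply: (@walk_critical _ _ W) => //; first exact: permute_triples_sub.
move/(critical_set_permute (s^-1)%g (t^-1)%g); rewrite permute_mxK.
suff -> : permute_triples s^-1 t^-1 (permute_triples s t C) = C by [].
by apply/setP=> -[[i j] b]; rewrite !inE /= !permKV.
Qed.
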